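(* Let $\Gamma$ be a finite connected graph. Let $\hat Y$ be the electrified Cayley graph of the right-angled Artin group $A(\Gamma)$ with respect to the generating set $V(\Gamma)$ and the collection of cosets $\coprod_{v\in V(\Gamma)} \langle \mathrm{St}(v)\rangle\backslash A(\Gamma)$, with its metric $\hat d$. Then the metric spaces $(A(\Gamma),d_* )$, $(\Gamma^e,d_{\Gamma^e})$ and $(\hat Y,\hat d)$ are quasi-isometric to each other.
   Context: Graphs are one-dimensional simplicial complexes (no loops or multi-edges). $A(\Gamma)=\langle V(\Gamma)\mid [a,b]=1 \text{ for each } \{a,b\}\in E(\Gamma)\rangle$. The star $\mathrm{St}(v)$ of a vertex $v$ is $v$ together with the vertices adjacent to $v$, and $\langle \mathrm{St}(v)\rangle\le A(\Gamma)$ is the subgroup generated by it. The extension graph $\Gamma^e$ has vertex set $\{v^g : v\in V(\Gamma), g\in A(\Gamma)\}$, where $v^g=g^{-1}vg$, with two distinct vertices adjacent if and only if they commute in $A(\Gamma)$; $d_{\Gamma^e}$ is the graph metric (edges of length one). $\Gamma^e$ is connected when $\Gamma$ is. The star length $\|g\|_*$ of $g\in A(\Gamma)$ is the minimum $\ell$ such that $g$ is a product of $\ell$ elements of $\bigcup_{v\in V(\Gamma)}\langle \mathrm{St}(v)\rangle$ (with $\|1\|_*=0$), and $d_*(g,h)=\|gh^{-1}\|_*$. Let $Y$ be the Cayley graph of $A(\Gamma)$ with respect to $V(\Gamma)\cup V(\Gamma)^{-1}$, with $g$ and $sg$ adjacent for each generator $s$ (so that right multiplication acts by isometries). The electrification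 $\hat Y$ is the graph with vertex set $A(\Gamma)\sqcup\coprod_{v\in V(\Gamma)}\langle \mathrm{St}(v)\rangle\backslash A(\Gamma)$, where $H\backslash G$ is the set of right cosets $Hg$ and cosets for different $v$ are regarded as distinct; its edges are the edges of $Y$, of length $1$, together with an edge $\{g,C\}$ of length $1/2$ whenever $g$ lies in a coset $C$ of the collection. $\hat d$ is the resulting path metric. *)

(* Defs.v *)
From HB Require Import structures.
From mathcomp Require Import all_boot all_order all_algebra.
From mathcomp Require Import boolp classical_sets reals.

Set Implicit Arguments.
Unset Strict Implicit.
Unset Printing Implicit Defensive.

Import Order.TTheory GRing.Theory Num.Theory.

Local Open Scope classical_set_scope.
Local Open Scope quotient_scope.
Local Open Scope group_scope.

Record sgraph := SGraph {
  vertex :> finType;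
  adj : rel vertex;
  adj_sym : symmetric adj;
  adj_irr : irreflexive adj
}.

(** The empty graph is not considered connected. *)
Definition connected_graph (G : sgraph) : Prop :=
  inhabited G /\ forall x y : G, connect (@adj G) x y.

(** The letter [(v, true)] stands for [v] and [(v, false)] for its inverse. *)
Definition raag_word (G : sgraph) := seq (G * bool).

(** Equality of the elements represented by two words: the congruence on words
    generated by the free cancellations and by the relations [ab = ba] for
    adjacent [a] and [b]. *)
Inductive word_eq (G : sgraph) : raag_word G -> raag_word G -> Prop :=
| Word_refl w : word_eq w w
| Word_sym w1 w2 : word_eq w1 w2 -> word_eq w2 w1
| Word_trans w1 w2 w3 : word_eq w1 w2 -> word_eq w2 w3 -> word_eq w1 w3
| Word_cancel u v a b :
    word_eq (u ++ [:: (a, b), (a, ~~ b) & v]) (u ++ v)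
| Word_comm u v a b : adj a b ->
    word_eq (u ++ [:: (a, true), (b, true) & v])
            (u ++ [:: (b, true), (a, true) & v]).

Definition word_eqb (G : sgraph) : rel (raag_word G) :=
  fun w1 w2 => `[< word_eq w1 w2 >].

Lemma word_eqb_refl G : reflexive (@word_eqb G).
Proof. by move=> w; apply/asboolP; exact: Word_refl. Qed.

Lemma word_eqb_sym G : symmetric (@word_eqb G).
Proof. by move=> w1 w2; apply/asboolP/asboolP => /Word_sym. Qed.

Lemma word_eqb_trans G : transitive (@word_eqb G).
Proof.
move=> w2 w1 w3 /asboolP h12 /asboolP h23; apply/asboolP.
exact: Word_trans h12 h23.
Qed.

Canonical word_equiv (G : sgraph) :=
  EquivRel (@word_eqb G) (@word_eqb_refl G) (@word_eqb_sym G)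
    (@word_eqb_trans G).

Definition raag (G : sgraph) := {eq_quot @word_eqb G}.

Section RaagGroup.
Variable G : sgraph.
Implicit Types (w u v : raag_word G) (x y z : raag G).

Definition word_inv w : raag_word G := rev [seq (a.1, ~~ a.2) | a <- w].

Definition raag_one : raag G := \pi_(raag G) [::].
Definition raag_mul x y : raag G := \pi_(raag G) (repr x ++ repr y).
Definition raag_inv x : raag G := \pi_(raag G) (word_inv (repr x)).

Lemma raag_eqP w1 w2 :
  \pi_(raag G) w1 = \pi_(raag G) w2 <-> word_eq w1 w2.
Proof.
split=> [/eqmodP/asboolP//|w12]; apply/eqmodP.
exact/asboolP.
Qed.

Lemma word_eq_cat2l u w1 w2 : word_eq w1 w2 -> word_eq (u ++ w1) (u ++ w2).
Proof.
elim=> [w|v1 v2 _|v1 v2 v3 _ h1 _ h2|u' v a b|u' v a b ab].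
- exact: Word_refl.
- exact: Word_sym.
- exact: Word_trans h1 h2.
- by rewrite !catA; exact: Word_cancel.
- by rewrite !catA; exact: Word_comm.
Qed.

Lemma word_eq_cat2r u w1 w2 : word_eq w1 w2 -> word_eq (w1 ++ u) (w2 ++ u).
Proof.
elim=> [w|v1 v2 _|v1 v2 v3 _ h1 _ h2|u' v a b|u' v a b ab].
- exact: Word_refl.
- exact: Word_sym.
- exact: Word_trans h1 h2.
- by rewrite -!catA; exact: Word_cancel.
- by rewrite -!catA; exact: Word_comm.
Qed.

Lemma word_eq_repr w : word_eq (repr (\pi_(raag G) w)) w.
Proof. by apply/raag_eqP; rewrite reprK. Qed.

Lemma raag_mulE w1 w2 :
  raag_mul (\pi_(raag G) w1) (\pi_(raag G) w2) = \pi_(raag G) (w1 ++ w2).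
Proof.
apply/raag_eqP; apply: (@Word_trans _ _ (w1 ++ repr (\pi_(raag G) w2))).
  exact/word_eq_cat2r/word_eq_repr.
exact/word_eq_cat2l/word_eq_repr.
Qed.

Lemma word_invVr w : word_eq (w ++ word_inv w) [::].
Proof.
elim/last_ind: w => [|w [a b] IH]; first exact: Word_refl.
rewrite /word_inv map_rcons rev_rcons cat_rcons.
exact: Word_trans (Word_cancel _ _ _ _) IH.
Qed.

Lemma word_invK w : word_inv (word_inv w) = w.
Proof.
rewrite /word_inv map_rev revK -map_comp -[RHS]map_id.
by apply: eq_map => -[a b] /=; rewrite negbK.
Qed.

Lemma word_invVl w : word_eq (word_inv w ++ w) [::].
Proof. by rewrite -[X in _ ++ X]word_invK; exact: word_invVr. Qed.

Lemma raag_ind (P : raag G -> Prop) :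
  (forall w, P (\pi_(raag G) w)) -> forall x, P x.
Proof. by move=> Pw x; have := Pw (repr x); rewrite reprK. Qed.

Lemma raag_mulA : associative raag_mul.
Proof.
elim/raag_ind=> u; elim/raag_ind=> v; elim/raag_ind=> w.
by rewrite !raag_mulE catA.
Qed.

Lemma raag_mul1 : left_id raag_one raag_mul.
Proof. by elim/raag_ind=> w; rewrite raag_mulE. Qed.

Lemma raag_mul1r : right_id raag_one raag_mul.
Proof. by elim/raag_ind=> w; rewrite raag_mulE cats0. Qed.

Lemma raag_mulVr : right_inverse raag_one raag_inv raag_mul.
Proof.
move=> x; have := raag_mulE (repr x) (word_inv (repr x)).
by rewrite reprK => ->; exact/raag_eqP/word_invVr.
Qed.

Lemma raag_mulV : left_inverse raag_one raag_inv raag_mul.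
Proof.
move=> x; have := raag_mulE (word_inv (repr x)) (repr x).
by rewrite reprK => ->; exact/raag_eqP/word_invVl.
Qed.

HB.instance Definition _ := Choice.on (raag G).
HB.instance Definition _ := isGroup.Build (raag G)
  raag_mulA raag_mul1 raag_mul1r raag_mulV raag_mulVr.

Definition raag_gen (a : G) : raag G := \pi_(raag G) [:: (a, true)].

End RaagGroup.

Definition is_subgroup (A : groupType) (H : set A) : Prop :=
  H 1 /\ forall x y, H x -> H y -> H (x / y).

Definition generated (A : groupType) (S : set A) : set A :=
  smallest (@is_subgroup A) S.

Definition right_coset (A : groupType) (H : set A) (g : A) : set A :=
  [set h * g | h in H].

Section Star.
Variable G : sgraph.

Definition star (v : G) : set G := [set w | w = v \/ adj v w].

Definition star_subgroup (v : G) : set (raag G) :=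
  generated (@raag_gen G @` star v).

Definition star_product (l : nat) (g : raag G) : Prop :=
  exists s : seq (raag G),
    [/\ size s = l,
        forall x, x \in s -> exists v, star_subgroup v x
      & g = \prod_(x <- s) x].

Lemma star_product_ex (g : raag G) : exists l, `[< star_product l g >].
Proof.
have letterP (a : G) b :
    star_subgroup a (\pi_(raag G) [:: (a, b)]).
  have ga : star_subgroup a (raag_gen a).
    by move=> H [_ SH]; apply: SH; exists a => //; left.
  case: b => // H HS; have [[H1 HV] _] := HS.
  have := HV _ _ H1 (ga H HS); rewrite mul1g.
  by rewrite [_^-1](_ : _ = \pi_(raag G) [:: (a, false)])//;
    apply: (mulgI (raag_gen a)); rewrite mulgV; apply/esym;
    rewrite [LHS]raag_mulE; apply/raag_eqP; exact: (Word_cancel [::]).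
rewrite -[g]reprK; elim: (repr g) => [|[a b] w [l /asboolP[s [_ sS sE]]]].
  by exists 0; apply/asboolP; exists [::]; split; rewrite ?big_nil.
exists (size s).+1; apply/asboolP; exists (\pi_(raag G) [:: (a, b)] :: s).
split=> // [x|]; first by rewrite inE => /predU1P[->|/sS//]; exists a.
by rewrite big_cons -sE; apply/esym; exact: raag_mulE.
Qed.

Definition star_length (g : raag G) : nat := ex_minn (star_product_ex g).

Definition star_dist (R : realType) (g h : raag G) : R :=
  ((star_length (g / h)%g)%:R)%R.

End Star.

(** A metric graph on the vertex set [V] is given by a relation [E], with
    [E a b l] meaning that there is an edge of length [l] with endpoints [a] and
    [b]; the edges are not oriented, and [E] need not be symmetric. *)
Section MetricGraph.
Local Open Scope ring_scope.
Variables (R : realType) (V : Type) (E : V -> V -> R -> Prop).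

(** Points of the geometric realization are given by their barycentric
    coordinates; [on_edge a b t] is the point of the edge [ab] at parameter [t],
    with [t = 0] at [a] and [t = 1] at [b]. *)
Definition on_edge (a b : V) (t : R) : V -> R :=
  fun x => (1 - t) * `[< x = a >]%:R + t * `[< x = b >]%:R.

Definition at_vertex (a : V) : V -> R := fun x => `[< x = a >]%:R.

Definition is_point (p : V -> R) : Prop :=
  (exists a, p = at_vertex a) \/
  exists a b l t, [/\ E a b l, 0 <= t <= 1 & p = on_edge a b t].

Definition realization := {p : V -> R | is_point p}.

(** [pl_path p q L]: there is a piecewise linear path of length [L] from [p]
    to [q], each piece being an affine segment inside one closed edge. *)
Inductive pl_path : realization -> realization -> R -> Prop :=
| PL_nil p : pl_path p p 0
| PL_cons p q r a b l s t L :
    E a b l -> 0 <= s <= 1 -> 0 <= t <= 1 ->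
    sval p = on_edge a b s -> sval q = on_edge a b t ->
    pl_path q r L -> pl_path p r (l * `|s - t| + L).

(** Meant for connected graphs: [inf] returns the junk value 0 on the empty set,
    i.e. for points in different components. *)
Definition path_metric (p q : realization) : R := inf [set L | pl_path p q L].

End MetricGraph.

Section ExtensionGraph.
Variables (R : realType) (G : sgraph).

Definition ext_vertex := {x : raag G | exists v g, x = raag_gen v ^ g}.

Definition ext_adj (x y : ext_vertex) : Prop :=
  x <> y /\ commute (sval x) (sval y).

Definition ext_edge (x y : ext_vertex) (l : R) : Prop :=
  ext_adj x y /\ l = 1%R.

Definition ext_graph := realization ext_edge.

Definition ext_dist : ext_graph -> ext_graph -> R :=
  @path_metric R ext_vertex ext_edge.

End ExtensionGraph.

Section Electrification.
Variables (R : realType) (G : sgraph).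

Definition star_coset (v : G) :=
  {C : set (raag G) | exists g, C = right_coset (star_subgroup v) g}.

Definition elec_vertex := (raag G + {v : G & star_coset v})%type.

Inductive elec_edge : elec_vertex -> elec_vertex -> R -> Prop :=
| Elec_cayley (g s : raag G) :
    (exists v : G, s = raag_gen v \/ s = (raag_gen v)^-1) ->
    elec_edge (inl g) (inl (s * g)) 1%R
| Elec_cone (g : raag G) (v : G) (C : star_coset v) :
    sval C g ->
    elec_edge (inl g) (inr (existT _ v C)) (2^-1)%R.

Definition elec_graph := realization elec_edge.

Definition elec_dist : elec_graph -> elec_graph -> R :=
  @path_metric R elec_vertex elec_edge.

End Electrification.

Definition quasi_isometry (R : realType) (X Y : Type)
    (dX : X -> X -> R) (dY : Y -> Y -> R) (f : X -> Y) : Prop :=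
  exists K C : R,
    [/\ (1 <= K)%R, (0 <= C)%R,
        forall x x', (K^-1 * dX x x' - C <= dY (f x) (f x') <= K * dX x x' + C)%R
      & forall y, exists x, (dY y (f x) <= C)%R].

Definition quasi_isometric (R : realType) (X Y : Type)
    (dX : X -> X -> R) (dY : Y -> Y -> R) : Prop :=
  exists f : X -> Y, quasi_isometry dX dY f.

(* Main.v *)
Require Import Defs.
From mathcomp Require Import all_boot all_order all_algebra.
From mathcomp Require Import boolp classical_sets reals.
From mathcomp Require Import ring lra zify.

Set Implicit Arguments.
Unset Strict Implicit.
Unset Printing Implicit Defensive.

Import Order.TTheory GRing.Theory Num.Theory.

Local Open Scope classical_set_scope.
Local Open Scope quotient_scope.
Local Open Scope group_scope.

(** Write [S_v] for [star_subgroup v]. Both graphs carry an equivariant map from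
    the group that is coarsely inverse to a map back: an orbit map
    [g |-> v0 ^ g] for the extension graph, the inclusion of the vertices for the
    electrification. Star length is compared with the path metric through a
    common criterion ([star_dist_quasi_isometric]) asking that
    - multiplying by an element of a star subgroup moves the image a bounded
      distance, which bounds the path metric by star length;
    - the map back sends the ends of an edge to elements at bounded star
      distance, which bounds star length by a multiple of the path metric;
    - the two maps be mutually inverse up to a bounded error.
    The third quasi-isometry is obtained from the other two by composition.

    In the electrification, a star generator moves a vertex to another vertex of
    the same coset, and one sends a coset to one of its elements. In the extension
    graph, an element of [S_w] fixes [w], so conjugating by it moves [v0] by at
    most twice the diameter of the graph. The substantial point is the map back:
    if [v ^ g] and [w ^ h] commute, then [g] and [h] are at star distance at most
    2 ([star_length_commute]). This follows from the centralizer of [v] being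
    [S_v] ([centralizer_gen]), together with the retraction of the group onto
    [S_v] that kills the other generators.

    For the centralizer, let [B] be generated by the vertices other than [v]. The
    kernel of the retraction onto [B] is free on the conjugates of [v] by [B],
    which are indexed by the cosets [S_v b] with [b] in [B]. This freeness shows
    in an action of the group on the reduced words over the right cosets of [S_v],
    where [v] appends the letter [S_v] and the other generators translate all
    letters.
    Running a word [g] from the empty state yields a reduced word [t], and [g] is
    recovered from [t] and from its image [b] in [B]. If [g] commutes with [v],
    then [(S_v b) t = t S_v] in the free group, so that [b] lies in [S_v] and [t]
    is a power of the letter [S_v].

    The metrics are infima over piecewise linear paths, whose pieces may be
    arbitrarily short. Lower bounds come from real functions on
    the vertices, Lipschitz along edges, extended affinely to the edges. *)

(** * Reduced words in a free group *)

Section FreeReduction.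
Variable X : eqType.
Implicit Types (c d : X * bool) (f t : seq (X * bool)).

Definition opp_letter c := (c.1, ~~ c.2).

Definition reduced f := sorted (fun c d => d != opp_letter c) f.

(** Words are stacks: the head of the list is the last letter of the word, so
    [push] is multiplication on the right. *)
Definition push c f :=
  if f is d :: f' then if d == opp_letter c then f' else c :: f else [:: c].

(** The product [f t] in the free group, reduced when [f] is. *)
Definition append t f := foldr push f t.

Lemma opp_letterK : involutive opp_letter.
Proof. by case=> x b; rewrite /opp_letter negbK. Qed.

Lemma push_reduced c f : reduced f -> reduced (push c f).
Proof.
case: f => //= d f red_f; case: ifP => [_|/negbT dc]; last by rewrite /= dc.
exact: path_sorted red_f.
Qed.

Lemma append_reduced t f : reduced f -> reduced (append t f).
Proof. by move=> red_f; elim: t => //= c t; exact: push_reduced. Qed.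

Lemma push_opp c f : reduced f -> push (opp_letter c) (push c f) = f.
Proof.
case: f => [|d f] /=; first by rewrite opp_letterK eqxx.
case: eqP => [->|_ _] /=; last by rewrite opp_letterK eqxx.
by case: f => //= e f /andP[/negPf->].
Qed.

Definition relabel (h : X -> X) f := [seq (h c.1, c.2) | c <- f].

Lemma relabel_push h c f : injective h ->
  relabel h (push c f) = push (h c.1, c.2) (relabel h f).
Proof.
move=> h_inj; case: f => //= -[x b] f /=.
rewrite /opp_letter !xpair_eqE (inj_eq h_inj).
by case: c => y b' /=; case: ifP.
Qed.

Lemma relabel_append h t f : injective h ->
  relabel h (append t f) = append (relabel h t) (relabel h f).
Proof. by move=> h_inj; elim: t => //= c t <-; exact: relabel_push. Qed.

Lemma relabel_reduced h f : injective h -> reduced f -> reduced (relabel h f).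
Proof.
move=> h_inj; rewrite /reduced sorted_map; apply: sub_sorted => -[x b] [y b'].
by rewrite /relpre /opp_letter /= !xpair_eqE (inj_eq h_inj).
Qed.

Lemma relabel_comp h1 h2 f : relabel h2 (relabel h1 f) = relabel (h2 \o h1) f.
Proof. by rewrite /relabel -map_comp. Qed.

Lemma append_push c t f :
  reduced f -> append (push c t) f = push c (append t f).
Proof.
case: t => //= d t red_f; case: eqP => //= ->.
by rewrite -{1}(opp_letterK c) push_opp //; exact: append_reduced.
Qed.

(** In the product [c t] only the first letter of [t], which is the end of the
    list, can cancel. *)
Lemma append1 c t : reduced t ->
  (exists2 t', t = rcons t' (opp_letter c) & append t [:: c] = t') \/
  append t [:: c] = rcons t c.
Proof.
elim: t => [|d t IH] red_t; first by right.
case: (IH (path_sorted red_t)) => [[t' tE /= ->]|/= ->].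
  left; exists (d :: t'); first by rewrite tE.
  by move: red_t; rewrite tE; case: t' {tE} => //= e t' /andP[/negPf->].
case: t {IH} red_t => [_|e t] /=; last by move=> /andP[/negPf->]; right.
case: eqP => [->|_]; last by right.
by left; exists [::]; rewrite ?opp_letterK.
Qed.

Lemma rcons_cons_const c d t : rcons t c = d :: t -> c = d /\ all (pred1 d) t.
Proof.
elim: t d => [|e t IH] d /=; first by case=> ->.
by case=> -> /IH[-> ->]; rewrite eqxx.
Qed.

Lemma push1 d t :
  (exists2 t', t = opp_letter d :: t' & push d t = t') \/ push d t = d :: t.
Proof.
case: t => [|e t] /=; first by right.
by case: eqP => [->|_]; [left; exists t | right].
Qed.

(** The equation [c t = t d] in a free group: the two sides differ from the
    reduced word [t] by one letter, at opposite ends, so that each letter of [t]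
    equals the next one. *)
Lemma append1_eq_push c d t : reduced t ->
  append t [:: c] = push d t -> c = d /\ all (fun e => e.1 == d.1) t.
Proof.
move=> red_t; have sE x s : all (pred1 x) s -> all (fun e => e.1 == x.1) s.
  by apply: sub_all => e /= /eqP->.
case: (append1 c red_t) => [[t1 tE ->]|->];
  case: (push1 d t) => [[t2 tE' ->]|->].
- move=> t12; move: tE'; rewrite tE t12 => /rcons_cons_const[cd /sE t2d].
  split; last by rewrite all_rcons cd eqxx.
  by apply: (can_inj opp_letterK).
- by move/(congr1 size); rewrite tE /= size_rcons; lia.
- by move/(congr1 size); rewrite tE' /= size_rcons /=; lia.
- by move=> /rcons_cons_const[cd /sE td].
Qed.

End FreeReduction.

(** * Words and retractions *)

Section Retraction.
Variable G : sgraph.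
Implicit Types (w : raag_word G) (x y g h : raag G) (T : pred G) (a : G).

(** The class of a word, with the group itself as its type, so that the group
    structure is inferred. *)
Definition word_val w : raag G := \pi_(raag G) w.

Definition letter (c : G * bool) : raag G := word_val [:: c].

Lemma pi_cat w1 w2 :
  word_val (w1 ++ w2) = word_val w1 * word_val w2.
Proof. by rewrite [RHS]raag_mulE. Qed.

Lemma pi_nil : word_val [::] = 1. Proof. by []. Qed.

Lemma letterV c : (letter c)^-1 = letter (c.1, ~~ c.2).
Proof.
apply: (mulgI (letter c)); rewrite mulgV -pi_cat; apply/esym/raag_eqP.
by case: c => a b; exact: (Word_cancel [::]).
Qed.

Lemma gen_commute (a b : G) : adj a b -> commute (raag_gen a) (raag_gen b).
Proof.
move=> ab; rewrite /commute -!pi_cat; apply/raag_eqP.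
exact: (Word_comm [::] [::]).
Qed.

Lemma letterE a b : letter (a, b) = if b then raag_gen a else (raag_gen a)^-1.
Proof. by case: b; rewrite // letterV. Qed.

(** The endomorphism fixing the generators in [T] and killing the others. *)
Definition retract T x : raag G := word_val [seq c <- repr x | T c.1].

Lemma word_eq_filter T w1 w2 : word_eq w1 w2 ->
  word_eq [seq c <- w1 | T c.1] [seq c <- w2 | T c.1].
Proof.
elim=> {w1 w2} [w|w1 w2 _|w1 w2 w3 _ h12 _|u v a b|u v a b ab].
- exact: Word_refl.
- exact: Word_sym.
- exact: Word_trans.
- rewrite !filter_cat /=.
  by case: (T a); [exact: Word_cancel | exact: Word_refl].
- rewrite !filter_cat /=; case: (T a); case: (T b); try exact: Word_refl.
  exact: Word_comm.
Qed.

Lemma retract_pi T w : retract T (word_val w) = word_val [seq c <- w | T c.1].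
Proof. exact/raag_eqP/word_eq_filter/word_eq_repr. Qed.

Lemma retractM T : {morph retract T : x y / x * y}.
Proof.
elim/raag_ind=> u; elim/raag_ind=> v.
by rewrite -pi_cat !retract_pi filter_cat pi_cat.
Qed.

Lemma retract1 T : retract T 1 = 1.
Proof. by rewrite -pi_nil retract_pi. Qed.

Lemma retractV T : {morph retract T : x / x^-1}.
Proof.
by move=> x; apply: (mulgI (retract T x)); rewrite -retractM !mulgV retract1.
Qed.

Lemma retractJ T x y : retract T (x ^ y) = retract T x ^ retract T y.
Proof. by rewrite !conjgE !retractM retractV. Qed.

Lemma retract_gen T a : retract T (raag_gen a) = if T a then raag_gen a else 1.
Proof. by rewrite retract_pi /=; case: ifP. Qed.

Lemma gen_neq1 a : raag_gen a != 1 :> raag G.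
Proof.
apply/eqP => /raag_eqP a1.
(* The parity of the length of a word depends only on its class. *)
suff /(_ _ _ a1) : forall w1 w2, word_eq w1 w2 -> odd (size w1) = odd (size w2).
  by [].
move=> w1 w2; elim=> //= [w3 w4 w5 _ -> _ //|u v b e|u v b e _].
  by rewrite !size_cat !oddD /= negbK.
by rewrite !size_cat.
Qed.

Lemma gen_inj : injective (@raag_gen G).
Proof.
move=> a b ab; apply/eqP; apply: contraT => nab.
have := congr1 (retract (pred1 a)) ab.
rewrite !retract_gen /= eqxx eq_sym (negPf nab).
by move/eqP; rewrite (negPf (gen_neq1 a)).
Qed.

End Retraction.

(** * Star subgroups *)

Section Subgroup.
Variables (A : groupType) (H : set A).
Hypothesis H_subgroup : is_subgroup H.

Lemma subgroup1 : H 1. Proof. exact: H_subgroup.1. Qed.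

Lemma subgroupV x : H x -> H x^-1.
Proof.
by move=> Hx; rewrite -div1g; apply: H_subgroup.2 => //; exact: subgroup1.
Qed.

Lemma subgroupM x y : H x -> H y -> H (x * y).
Proof. by move=> Hx /subgroupV Hy; rewrite -[y]invgK; exact: H_subgroup.2. Qed.

Lemma right_coset_id x : H x -> right_coset H x = H.
Proof.
move=> Hx; apply/seteqP; split=> [_ [h Hh <-]|h Hh]; first exact: subgroupM.
by exists (h / x); [exact: H_subgroup.2 | rewrite mulgVK].
Qed.

End Subgroup.

Lemma right_cosetM (A : groupType) (S : set A) x y :
  right_coset (right_coset S x) y = right_coset S (x * y).
Proof.
apply/seteqP; split=> [_ [_ [s Ss <-] <-]|_ [s Ss <-]].
  by exists s; rewrite ?mulgA.
by exists (s * x); [exists s | rewrite mulgA].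
Qed.

Lemma right_coset1 (A : groupType) (S : set A) : right_coset S 1 = S.
Proof.
apply/seteqP; split=> [_ [s Ss <-]|s Ss]; first by rewrite mulg1.
by exists s; rewrite ?mulg1.
Qed.

Lemma right_coset_inj (A : groupType) (x : A) :
  injective ((@right_coset A)^~ x).
Proof.
move=> S1 S2 /(congr1 ((@right_coset A)^~ x^-1)).
by rewrite /= !right_cosetM mulgV !right_coset1.
Qed.

Section StarSubgroup.
Variable G : sgraph.
Implicit Types (v w : G) (x y g h : raag G).

Lemma star_subgroupP v : is_subgroup (@star_subgroup G v).
Proof.
split=> [K [[K1 _] _] //|x y Sx Sy K KP].
by case: (KP) => -[_ KV] _; apply: KV; [exact: Sx | exact: Sy].
Qed.

Lemma star_subgroup1 v : star_subgroup v 1.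
Proof. exact: (subgroup1 (star_subgroupP v)). Qed.

Lemma star_subgroupV v x : star_subgroup v x -> star_subgroup v x^-1.
Proof. exact: (subgroupV (star_subgroupP v)). Qed.

Lemma star_subgroupM v x y :
  star_subgroup v x -> star_subgroup v y -> star_subgroup v (x * y).
Proof. exact: (subgroupM (star_subgroupP v)). Qed.

Lemma star_subgroup_min v (K : set (raag G)) : is_subgroup K ->
  (forall w, w = v \/ adj v w -> K (raag_gen w)) -> @star_subgroup G v `<=` K.
Proof.
move=> Kg genK; apply: smallest_sub => // _ [w vw <-]; exact: genK.
Qed.

Lemma star_subgroup_gen v w : w = v \/ adj v w -> star_subgroup v (raag_gen w).
Proof. by move=> vw K [_ SK]; apply: SK; exists w. Qed.

Lemma star_subgroup_letter v w b :
  w = v \/ adj v w -> star_subgroup v (letter (w, b)).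
Proof.
move=> /star_subgroup_gen vw; rewrite letterE; case: b => //.
exact: star_subgroupV.
Qed.

Lemma star_subgroup_centralizes v x :
  star_subgroup v x -> commute (raag_gen v) x.
Proof.
apply: star_subgroup_min x; first split.
- exact: commute1.
- by move=> x y vx vy; apply: commuteM => //; exact: commuteV.
by move=> w [->|vw] /=; [exact: commute_refl | exact: gen_commute].
Qed.

Lemma star_subgroup_word v (s : raag_word G) :
    (forall c, c \in s -> c.1 = v \/ adj v c.1) ->
  star_subgroup v (word_val s).
Proof.
elim: s => [|[a b] s IH] vs; first exact: star_subgroup1.
rewrite -cat1s pi_cat; apply: star_subgroupM.
  by apply: star_subgroup_letter; apply: (vs (a, b)); rewrite mem_head.
by apply: IH => c cs; apply: vs; rewrite inE cs orbT.
Qed.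

End StarSubgroup.

(** * Centralizers of the generators *)

Section Centralizer.
Variables (G : sgraph) (v : G).
Implicit Types (w : raag_word G) (x y g : raag G).
Implicit Types f : seq (set (raag G) * bool).

Local Notation H := (@star_subgroup G v).
Local Notation translate x := ((@right_coset (raag G))^~ x).
Local Notation kill := (retract (predC1 v)).

(** The action of the letters on the states. A letter [(S_v x, true)] of a state
    stands for the conjugate [v ^ x], which only depends on the coset because
    [S_v] centralizes [v]. *)
Definition coset_step f c :=
  if c.1 == v then push (H, c.2) f else relabel (translate (letter c)) f.

Definition coset_run f w := foldl coset_step f w.

Lemma coset_step_reduced f c : reduced f -> reduced (coset_step f c).
Proof.
rewrite /coset_step; case: ifP => _; first exact: push_reduced.
by apply: relabel_reduced; exact: right_coset_inj.
Qed.

Lemma coset_run_reduced f w : reduced f -> reduced (coset_run f w).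
Proof. by elim: w f => //= c w IH f /(coset_step_reduced c)/IH. Qed.

Lemma relabel_translate x y f :
  relabel (translate y) (relabel (translate x) f) =
  relabel (translate (x * y)) f.
Proof.
rewrite relabel_comp; apply: eq_map => -[S b] /=.
by rewrite right_cosetM.
Qed.

Lemma relabel_translate1 f : relabel (translate 1) f = f.
Proof.
by elim: f => //= -[S b] f ->; rewrite right_coset1.
Qed.

Lemma coset_step_cancel f a b :
  reduced f -> coset_step (coset_step f (a, b)) (a, ~~ b) = f.
Proof.
move=> red_f; rewrite /coset_step /=; case: eqP => [_|_].
  exact: (push_opp (H, b) red_f).
by rewrite relabel_translate -(letterV (a, b)) mulgV relabel_translate1.
Qed.

(** A vertex [a] adjacent to [v] lies in [S_v], so translation by [a] fixes the
    letter [S_v]; this is where the action respects the relation [a v = v a]. *)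
Lemma coset_step_star f a b : adj v a ->
  coset_step (push (H, true) f) (a, b) = push (H, true) (coset_step f (a, b)).
Proof.
move=> va; have /negPf av : a != v.
  by apply/eqP => av; rewrite av adj_irr in va.
have Ha : H (letter (a, b)) by apply: star_subgroup_letter; right.
rewrite /coset_step /= av relabel_push; last exact: right_coset_inj.
by rewrite (right_coset_id (star_subgroupP v) Ha).
Qed.

Lemma coset_step_comm f a b : adj a b ->
  coset_step (coset_step f (a, true)) (b, true) =
  coset_step (coset_step f (b, true)) (a, true).
Proof.
move=> ab; have [av|av] := eqVneq a v.
  rewrite av in ab *.
  rewrite [in LHS]/(coset_step f) eqxx coset_step_star //.
  by rewrite [RHS]/coset_step eqxx.
have [bv|bv] := eqVneq b v.
  rewrite bv in ab *; rewrite adj_sym in ab.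
  rewrite [in RHS]/(coset_step f) eqxx coset_step_star //.
  by rewrite [LHS]/coset_step eqxx.
rewrite /coset_step /= (negPf av) (negPf bv) !relabel_translate.
by rewrite [letter _ * _](gen_commute ab).
Qed.

(** On a state that is not reduced, cancelling letters need not act trivially. *)
Lemma coset_run_eq w1 w2 f :
  word_eq w1 w2 -> reduced f -> coset_run f w1 = coset_run f w2.
Proof.
move=> w12; elim: w12 f => {w1 w2} //.
- by move=> w1 w2 _ IH f red_f; rewrite IH.
- by move=> w1 w2 w3 _ IH1 _ IH2 f red_f; rewrite IH1 ?IH2.
- move=> u w a b f red_f; rewrite /coset_run !foldl_cat /= coset_step_cancel //.
  exact: coset_run_reduced.
- by move=> u w a b ab f _; rewrite /coset_run !foldl_cat /= coset_step_comm.
Qed.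

(** The action is affine: the letters [v] contribute a product that does not
    depend on the state, and the other letters a translation. *)
Lemma coset_run_append f w : reduced f ->
  coset_run f w =
  append (coset_run [::] w) (relabel (translate (kill (word_val w))) f).
Proof.
move=> red_f; elim/last_ind: w => [|w c IH].
  by rewrite /= retract_pi relabel_translate1.
have -> : kill (word_val (rcons w c)) = kill (word_val w) * kill (letter c).
  by rewrite -cats1 pi_cat retractM.
rewrite /coset_run !foldl_rcons -!/(coset_run _ _) IH.
rewrite [kill (letter c)]retract_pi.
rewrite /coset_step /=; case: ifPn => [/eqP cv|cv] /=.
  rewrite mulg1 append_push //; apply: relabel_reduced => //.
  exact: right_coset_inj.
rewrite relabel_append; last exact: right_coset_inj.
by rewrite relabel_translate.
Qed.

(** The conjugate of [v], or its inverse, that a letter stands for. *)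
Definition coset_letter_val (c : set (raag G) * bool) : raag G :=
  let x := raag_gen v ^ xget 1 c.1 in if c.2 then x else x^-1.

Definition state_val f := foldr (fun c x => x * coset_letter_val c) 1 f.

Lemma state_val_push c f :
  state_val (push c f) = state_val f * coset_letter_val c.
Proof.
case: f => //= d f; case: eqP => [->|//].
rewrite /coset_letter_val /=; case: c.2 => /=; first by rewrite mulgVK.
by rewrite mulgK.
Qed.

Definition coset_state f :=
  forall c, c \in f -> exists x, c.1 = right_coset H x.

Lemma coset_letter_valE x b :
  coset_letter_val (right_coset H x, b) =
  if b then raag_gen v ^ x else (raag_gen v ^ x)^-1.
Proof.
rewrite /coset_letter_val /=; suff -> : raag_gen v ^ xget 1 (right_coset H x) =
  raag_gen v ^ x by [].
have : right_coset H x (xget 1 (right_coset H x)).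
  by apply: (@xgetI _ _ _ x); exists 1; [exact: star_subgroup1 | rewrite mul1g].
case=> h /star_subgroup_centralizes vh <-.
by rewrite conjgM [raag_gen v ^ h]conjgE vh mulKg.
Qed.

Lemma coset_letter_val_star b : coset_letter_val (H, b) = letter (v, b).
Proof.
by rewrite -[H in LHS]right_coset1 coset_letter_valE conjg1 letterE.
Qed.

Lemma state_val_relabel x f : coset_state f ->
  state_val (relabel (translate x) f) = state_val f ^ x.
Proof.
elim: f => [|[S b] f IH] fC /=; first by rewrite conj1g.
rewrite IH => [|c cf]; last by apply: fC; rewrite inE cf orbT.
have [y /= ->] := fC (S, b) (mem_head _ _).
rewrite right_cosetM !coset_letter_valE conjMg conjgM.
by case: b {fC}; rewrite ?conjVg.
Qed.

Lemma coset_step_state f c : coset_state f -> coset_state (coset_step f c).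
Proof.
move=> fC d; rewrite /coset_step; case: ifP => _.
  have HC : exists x, H = right_coset H x by exists 1; rewrite right_coset1.
  case: f fC => [|e f] fC /=; first by rewrite inE => /eqP->.
  case: ifP => _ df; first by apply: fC; rewrite inE df orbT.
  by move: df; rewrite inE => /predU1P[->|/fC].
case/mapP => e /fC[x ex] -> /=; exists (x * letter c).
by rewrite ex right_cosetM.
Qed.

(** A word is recovered from its final state and its image in the subgroup
    generated by the vertices other than [v]. *)
Lemma word_val_run w :
  word_val w = kill (word_val w) * state_val (coset_run [::] w).
Proof.
suff [] : coset_state (coset_run [::] w) /\
  word_val w = kill (word_val w) * state_val (coset_run [::] w) by [].
elim/last_ind: w => [|w c [wC IH]].
  by split=> //=; rewrite retract_pi mulg1.
rewrite /coset_run foldl_rcons -/(coset_run _ _); split.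
  exact: coset_step_state.
rewrite -cats1 pi_cat retractM -/(letter c) {1}IH /coset_step.
rewrite [kill (letter c)]retract_pi /=; case: eqP => [cv|_] /=.
  rewrite state_val_push mulg1 mulgA; congr (_ * _).
  by rewrite coset_letter_val_star -cv; case: (c).
by rewrite state_val_relabel // conjgE -/(letter c) -!mulgA mulVKg.
Qed.

(** The words [v w] and [w v] lead from the empty state to [(S_v b) t] and to
    [t S_v], with [b] the image of [w] and [t] its final state. *)
Theorem centralizer_gen g : commute (raag_gen v) g -> star_subgroup v g.
Proof.
rewrite -[g]reprK -/(word_val _); set w := repr g => vg.
have vw : word_eq ((v, true) :: w) (rcons w (v, true)).
  rewrite -cats1 -cat1s; apply/raag_eqP; rewrite -!/(word_val _) !pi_cat.
  exact: vg.
have red_w : reduced (coset_run [::] w) by apply: coset_run_reduced.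
have := coset_run_eq vw (isT : reduced [::]).
have step_v f : coset_step f (v, true) = push (H, true) f.
  by rewrite /coset_step eqxx.
rewrite /coset_run foldl_rcons /= !step_v -!/(coset_run _ _).
rewrite coset_run_append // => /(append1_eq_push red_w)[[kH] wH].
rewrite word_val_run; apply: star_subgroupM.
  by rewrite -kH; exists 1; [exact: star_subgroup1 | rewrite mul1g].
elim: (coset_run [::] w) wH => [_|[S b] f IH /= /andP[/eqP-> /IH fH]].
  exact: star_subgroup1.
apply: star_subgroupM => //; rewrite coset_letter_val_star.
by apply: star_subgroup_letter; left.
Qed.

End Centralizer.

(** * Star length *)

Lemma commute_conj (A : groupType) (z x y : A) :
  commute x y -> commute (x ^ z) (y ^ z).
Proof. by rewrite /commute -conjMg => ->; rewrite conjMg. Qed.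

Section StarLength.
Variable G : sgraph.
Implicit Types (v w : G) (x y g h : raag G).

Lemma star_subgroup_retract v x :
  star_subgroup v x -> retract (fun w => (w == v) || adj v w) x = x.
Proof.
apply: (@star_subgroup_min G v [set y | retract _ y = y]) x; first split.
- exact: retract1.
- by move=> x y /= xE yE; rewrite retractM retractV xE yE.
by move=> w [->|vw] /=; rewrite retract_gen ?eqxx // vw orbT.
Qed.

Lemma retract_star_subgroup v x :
  star_subgroup v (retract (fun w => (w == v) || adj v w) x).
Proof.
apply: star_subgroup_word => c; rewrite mem_filter => /andP[/orP[/eqP|] + _].
  by left.
by right.
Qed.

(** Commuting conjugates are simultaneously conjugate to generators, by [y g].
    With [x = h / g], the element [w ^ x] centralizes [v], hence lies in the star
    subgroup of [v]; retracting onto this subgroup sends [x] to an element [y]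
    with [w ^ y = w ^ x]. *)
Lemma commute_conj_gen v w g h :
    commute (raag_gen v ^ g) (raag_gen w ^ h) ->
  exists2 y, star_subgroup v y & star_subgroup w (h / (y * g)).
Proof.
move=> vw; set T := fun u : G => (u == v) || adj v u.
have wS : star_subgroup v (raag_gen w ^ (h / g)).
  apply: centralizer_gen; move/(commute_conj g^-1): vw.
  by rewrite -!conjgM mulgV conjg1.
have wE := star_subgroup_retract wS; rewrite retractJ retract_gen in wE.
case: ifP wE => _ wE; last first.
  (* Outside the star, [w ^ x] would be trivial. *)
  by case/eqP: (gen_neq1 w); apply: (@conjg_inj _ (h / g)); rewrite -wE !conj1g.
exists (retract T (h / g)); first exact: retract_star_subgroup.
apply: centralizer_gen; rewrite /commute conjgC; congr (_ * _).
by rewrite invgM mulgA conjgM -wE -conjgM mulgV conjg1.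
Qed.

Lemma star_lengthP g : star_product (star_length g) g.
Proof. by rewrite /star_length; case: ex_minnP => n /asboolP. Qed.

Lemma star_length_le l g : star_product l g -> star_length g <= l.
Proof.
by move=> gl; rewrite /star_length; case: ex_minnP => n _; apply; apply/asboolP.
Qed.

Lemma star_length1 : star_length (1 : raag G) = 0%N.
Proof.
apply/eqP; rewrite -leqn0; apply: star_length_le.
by exists [::]; split; rewrite ?big_nil.
Qed.

Lemma star_lengthM g h : star_length (g * h) <= star_length g + star_length h.
Proof.
have [s [<- sS gE]] := star_lengthP g; have [t [<- tS hE]] := star_lengthP h.
apply: star_length_le; exists (s ++ t); split; first by rewrite size_cat.
  by move=> x; rewrite mem_cat => /orP[/sS|/tS].
by rewrite big_cat /= -gE -hE.
Qed.

Lemma star_lengthV g : star_length g^-1 = star_length g.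
Proof.
have half x : star_length x^-1 <= star_length x.
  have [s [sx sS xE]] := star_lengthP x.
  apply: star_length_le; exists (rev [seq y^-1 | y <- s]); split.
  - by rewrite size_rev size_map.
  - move=> y; rewrite mem_rev => /mapP[z /sS[v vz] ->]; exists v.
    exact: star_subgroupV.
  by rewrite xE -map_rev big_map prodgV revK.
by apply/eqP; rewrite eqn_leq half -{1}[g]invgK half.
Qed.

Lemma star_length_star v g : star_subgroup v g -> star_length g <= 1.
Proof.
move=> vg; apply: star_length_le; exists [:: g]; split=> //.
  by move=> x; rewrite inE => /eqP->; exists v.
by rewrite big_seq1.
Qed.

Lemma star_length_commute v w g h :
  commute (raag_gen v ^ g) (raag_gen w ^ h) -> star_length (g / h) <= 2.
Proof.
move=> /commute_conj_gen[y vy whg].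
rewrite -star_lengthV invgF -[h / g](divgKA (y * g)) mulgK.
apply: leq_trans (star_lengthM _ _) _.
exact: (leq_add (star_length_star whg) (star_length_star vy)).
Qed.

Lemma star_length_div g h : star_length (g / h) = star_length (h / g).
Proof. by rewrite -star_lengthV invgF. Qed.

Lemma star_length_triangle x g h :
  star_length (g / h) <= star_length (g / x) + star_length (x / h).
Proof. by rewrite -[g / h](divgKA x) star_lengthM. Qed.

End StarLength.

(** * Metric graphs *)

Section MetricGraphTheory.
Local Open Scope ring_scope.
Variables (R : realType) (V : Type) (E : V -> V -> R -> Prop).
Hypothesis edge_ge0 : forall a b l, E a b l -> 0 <= l.
Implicit Types (p q r : realization E) (a b : V) (L l s t : R).

Definition vertex_point a : realization E :=
  exist _ (@at_vertex R V a) (or_introl (ex_intro _ a erefl)).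

Lemma on_edge0 a b : on_edge a b 0 = @at_vertex R V a.
Proof. by apply/funext => x; rewrite /on_edge subr0 mul1r mul0r addr0. Qed.

Lemma on_edge1 a b : on_edge a b 1 = @at_vertex R V b.
Proof. by apply/funext => x; rewrite /on_edge subrr mul1r mul0r add0r. Qed.

Lemma pl_path_ge0 p q L : pl_path p q L -> 0 <= L.
Proof.
elim=> // {}p {}q r a b l s t {}L /edge_ge0 l0 _ _ _ _ _ L0.
by rewrite addr_ge0 // mulr_ge0.
Qed.

Lemma pl_path_cat p q r L1 L2 :
  pl_path p q L1 -> pl_path q r L2 -> pl_path p r (L1 + L2).
Proof.
move=> pq qr; elim: pq qr => [p' /=|]; first by rewrite add0r.
move=> p' q' r' a b l s t L ab s01 t01 pE qE _ IH /IH qr.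
by rewrite -addrA; exact: PL_cons ab s01 t01 pE qE qr.
Qed.

Lemma pl_path_sym p q L : pl_path p q L -> pl_path q p L.
Proof.
elim=> [p'|p' q' r a b l s t L' ab s01 t01 pE qE _ IH]; first exact: PL_nil.
have qp : pl_path q' p' (l * `|t - s| + 0).
  by apply: PL_cons ab t01 s01 qE pE _; exact: PL_nil.
by rewrite addrC distrC -[l * _]addr0; exact: pl_path_cat IH qp.
Qed.

Lemma pl_path_edge a b l :
  E a b l -> pl_path (vertex_point a) (vertex_point b) l.
Proof.
move=> ab; have -> : l = l * `|0 - 1| + 0.
  by rewrite sub0r normrN normr1 mulr1 addr0.
apply: PL_cons ab _ _ _ _ (PL_nil _); rewrite ?lexx ?ler01 //=.
  by rewrite on_edge0.
by rewrite on_edge1.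
Qed.

Lemma path_metric_le p q L : pl_path p q L -> path_metric p q <= L.
Proof.
by move=> pqL; apply: ge_inf => //; exists 0 => L' /= /pl_path_ge0.
Qed.

Lemma path_metric_sym p q : path_metric p q = path_metric q p.
Proof.
by congr inf; apply/seteqP; split=> L /=; exact: pl_path_sym.
Qed.

(** A bound on [path_metric p q] that also records that [p] and [q] are in the
    same component, which the infimum does not. *)
Definition joined_within N p q := exists2 L, L <= N & pl_path p q L.

Lemma joined_within_sym N p q : joined_within N p q -> joined_within N q p.
Proof. by case=> L LN /pl_path_sym pq; exists L. Qed.

Lemma joined_within_refl N p : 0 <= N -> joined_within N p p.
Proof. by move=> N0; exists 0 => //; exact: PL_nil. Qed.

Lemma joined_within_trans N1 N2 q p r : joined_within N1 p q ->
  joined_within N2 q r -> joined_within (N1 + N2) p r.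
Proof.
move=> [L1 LN1 pq] [L2 LN2 qr]; exists (L1 + L2); first exact: lerD.
exact: pl_path_cat pq qr.
Qed.

Lemma joined_within_le N1 N2 p q :
  N1 <= N2 -> joined_within N1 p q -> joined_within N2 p q.
Proof. by move=> N12 [L LN pq]; exists L => //; exact: le_trans N12. Qed.

Lemma path_metric_joined N p q : joined_within N p q -> path_metric p q <= N.
Proof. by case=> L LN /path_metric_le/le_trans; exact. Qed.

Lemma point_near_vertex p : (forall a b l, E a b l -> l <= 1) ->
  exists a, joined_within 1 p (vertex_point a).
Proof.
move=> edge_le1; case: (svalP p) => [[a pE]|[a [b [l [t [ab t01 pE]]]]]].
  exists a; suff -> : p = vertex_point a by exact: joined_within_refl.
  by case: p pE => p pP /= pE; exact: eq_exist.
exists a, (l * `|t - 0| + 0); last first.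
  by apply: PL_cons ab t01 _ pE _ (PL_nil _); rewrite ?lexx ?ler01 //= on_edge0.
have /andP[t0 t1] := t01; rewrite subr0 addr0 ger0_norm //.
by apply: mulr_ile1 => //; [exact: edge_ge0 ab | exact: edge_le1 ab].
Qed.

Section Connected.
Hypothesis joined : forall p q, exists N, joined_within N p q.

Lemma path_metric_ge p q x :
  (forall L, pl_path p q L -> x <= L) -> x <= path_metric p q.
Proof.
move=> xL; have [N [L _ pq]] := joined p q.
by apply: lb_le_inf; [exists L | move=> L'; exact: xL].
Qed.

Lemma path_metric_triangle q p r :
  path_metric p r <= path_metric p q + path_metric q r.
Proof.
rewrite -lerBlDr; apply: path_metric_ge => L1 pq.
rewrite lerBlDr -lerBlDl; apply: path_metric_ge => L2 qr.
by rewrite lerBlDl; apply: path_metric_le; exact: pl_path_cat pq qr.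
Qed.

End Connected.

Section AffineExtension.
Variables (phi : V -> R).

(** The affine extension of [phi] to the edges. It is a relation because a point
    determines neither the edge that contains it nor its orientation;
    [affine_value_inj] shows that this does not matter. *)
Definition affine_value p (y : R) := exists a b t,
  sval p = on_edge a b t /\ y = (1 - t) * phi a + t * phi b.

Lemma affine_value_vertex a : affine_value (vertex_point a) (phi a).
Proof.
by exists a, a, 0; split; [rewrite on_edge0 | rewrite subr0 mul1r mul0r addr0].
Qed.

(** The affine extension as a sum over all coordinates, in which the edge no
    longer appears. *)
Lemma sum_on_edge (s : seq {classic V}) a b t :
    uniq s -> (a : {classic V}) \in s -> (b : {classic V}) \in s ->
  \sum_(x <- s) on_edge a b t x * phi x = (1 - t) * phi a + t * phi b.
Proof.
move=> s_uniq as_ bs; have sumE (c : {classic V}) : c \in s ->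
    \sum_(x <- s) (`[< x = c >]%:R * phi x) = phi c.
  move=> cs; rewrite (bigD1_seq c) //= asboolT // mul1r big1 ?addr0 // => x xc.
  by rewrite asboolF ?mul0r //; exact/eqP.
rewrite -(sumE a as_) -(sumE b bs) !mulr_sumr -big_split /=.
by apply: eq_bigr => x _; rewrite /on_edge mulrDl !mulrA.
Qed.

Lemma affine_value_inj p y z : affine_value p y -> affine_value p z -> y = z.
Proof.
move=> [a [b [t [pE ->]]]] [c [d [u [pE' ->]]]].
pose s := @undup {classic V} [:: a; b; c; d].
rewrite -!(@sum_on_edge s) ?undup_uniq ?mem_undup ?inE ?eqxx ?orbT //.
by rewrite -pE pE'.
Qed.

(** On each affine piece the extension varies proportionally to arc length, so
    a Lipschitz bound on the edges passes to all paths, however short their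
    pieces. *)
Lemma affine_value_lipschitz K p q L y z :
    (forall a b l, E a b l -> `|phi a - phi b| <= K * l) ->
  pl_path p q L -> affine_value p y -> affine_value q z -> `|y - z| <= K * L.
Proof.
move=> phiK pq; elim: pq y => [p' y yp /(affine_value_inj yp)->|].
  by rewrite subrr normr0 mulr0.
move=> p' q' r a b l s t L' ab s01 t01 pE qE _ IH y yp zr.
have yE : y = (1 - s) * phi a + s * phi b.
  by apply: (affine_value_inj yp); exists a, b, s.
pose y' := (1 - t) * phi a + t * phi b.
have yq : affine_value q' y' by exists a, b, t.
rewrite mulrDr -(subrKA y'); apply: le_trans (ler_normD _ _) _.
apply: lerD; last exact: IH.
rewrite [y - y'](_ : _ = (t - s) * (phi a - phi b)); last first.
  by rewrite yE /y'; ring.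
by rewrite normrM distrC mulrC mulrA ler_wpM2r // phiK.
Qed.

End AffineExtension.

Lemma vertex_lipschitz (phi : V -> R) K a b L :
    (forall a b l, E a b l -> `|phi a - phi b| <= K * l) ->
  pl_path (vertex_point a) (vertex_point b) L -> `|phi a - phi b| <= K * L.
Proof.
move=> phiK /(affine_value_lipschitz phiK).
by apply; exact: affine_value_vertex.
Qed.

End MetricGraphTheory.

(** * Quasi-isometries *)

Section QuasiIsometry.
Local Open Scope ring_scope.
Variable R : realType.

(** A coarse inverse of the first map, followed by the second one. *)
Lemma quasi_isometric_span (X Y Z : Type) (dX : X -> X -> R) (dY : Y -> Y -> R)
    (dZ : Z -> Z -> R) :
    (forall y y', dY y y' = dY y' y) ->
    (forall y1 y2 y3, dY y1 y3 <= dY y1 y2 + dY y2 y3) ->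
    (forall z1 z2 z3, dZ z1 z3 <= dZ z1 z2 + dZ z2 z3) ->
  quasi_isometric dX dY -> quasi_isometric dX dZ -> quasi_isometric dY dZ.
Proof.
move=> symY triY triZ [f [K [C [K1 C0 fK /choice[h hC]]]]].
move=> [g [K' [C' [K'1 C'0 gK gC]]]].
have K0 : 0 < K by exact: lt_le_trans K1.
have K'0 : 0 < K' by exact: lt_le_trans K'1.
have fupper x x' : dY (f x) (f x') <= K * dX x x' + C by case/andP: (fK x x').
have flower x x' : dX x x' <= K * (dY (f x) (f x') + C).
  by case/andP: (fK x x') => + _; rewrite lerBlDr ler_pdivrMl.
have gupper x x' : dZ (g x) (g x') <= K' * dX x x' + C'.
  by case/andP: (gK x x').
have glower x x' : dX x x' <= K' * (dZ (g x) (g x') + C').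
  by case/andP: (gK x x') => + _; rewrite lerBlDr ler_pdivrMl.
have hupper y y' : dY (f (h y)) (f (h y')) <= dY y y' + 2 * C.
  have := triY (f (h y)) y (f (h y')); have := triY y y' (f (h y')).
  by have := hC y; have := hC y'; rewrite (symY (f (h y)) y); lra.
have hlower y y' : dY y y' <= dY (f (h y)) (f (h y')) + 2 * C.
  have := triY y (f (h y)) y'; have := triY (f (h y)) (f (h y')) y'.
  by have := hC y; have := hC y'; rewrite (symY (f (h y')) y'); lra.
have KK'1 : 1 <= K * K' by rewrite -[1]mulr1 ler_pM.
have KK'0 : 0 < K * K' by rewrite mulr_gt0.
have KK'C : C <= K * K' * C by rewrite ler_peMl.
have KK'C' : C' <= K * K' * C' by rewrite ler_peMl.
exists (g \o h), (K * K'), (3 * (K * K' * C) + 2 * C'); split=> //.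
- by lra.
- move=> y y' /=; apply/andP; split.
    rewrite lerBlDr ler_pdivrMl //.
    have h1 : K * dX (h y) (h y') <= K * (K' * (dZ (g (h y)) (g (h y')) + C')).
      by rewrite ler_pM2l.
    have h2 : K * K' * (3 * C) <= K * K' * (3 * (K * K' * C)).
      by rewrite ler_pM2l //; lra.
    have h3 : K * K' * C' <= K * K' * (2 * C') by rewrite ler_pM2l //; lra.
    by have := hlower y y'; have := fupper (h y) (h y'); lra.
  have h1 : K' * dX (h y) (h y') <= K' * (K * (dY y y' + 3 * C)).
    rewrite ler_pM2l //; apply: le_trans (flower _ _) _; rewrite ler_pM2l //.
    by have := hupper y y'; lra.
  by have := gupper (h y) (h y'); lra.
move=> z; have [x zx] := gC z; exists (f x) => /=.
have h1 : K' * dX x (h (f x)) <= K' * (K * (2 * C)).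
  rewrite ler_pM2l //; apply: le_trans (flower _ _) _; rewrite ler_pM2l //.
  by have := hC (f x); lra.
by have := gupper x (h (f x)); have := triZ z (g x) (g (h (f x))); lra.
Qed.

End QuasiIsometry.

(** * Metric graphs quasi-isometric to the star metric *)

Section StarMetricGraph.
Local Open Scope ring_scope.
Variables (R : realType) (G : sgraph) (V : Type) (E : V -> V -> R -> Prop).
Variables (F : raag G -> V) (r : V -> raag G) (N : nat).
Hypothesis edge_length : forall a b l, E a b l -> 2^-1 <= l <= 1.
Hypothesis edge_star : forall a b l,
  E a b l -> (star_length (r a / r b)%g <= N)%N.
Hypothesis orbit_star : forall g : raag G, (star_length (g / r (F g))%g <= N)%N.
Hypothesis star_joined : forall v x g, star_subgroup v x ->
  joined_within N%:R (vertex_point E (F g)) (vertex_point E (F (x * g)%g)).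
Hypothesis orbit_near : forall a,
  exists g, joined_within N%:R (vertex_point E (F g)) (vertex_point E a).

Local Notation orbit g := (vertex_point E (F g)).

Let edge_ge0 a b l : E a b l -> 0 <= l.
Proof. by case/edge_length/andP => + _; apply: le_trans; rewrite invr_ge0. Qed.

(** With [g = x1 ... xn h], the points of [h], [xn h], ..., [g] follow each other
    at bounded distance. *)
Lemma orbit_joined g h :
  joined_within (N%:R * (star_length (g / h)%g)%:R) (orbit h) (orbit g).
Proof.
have [s [<- sS]] := star_lengthP (g / h)%g.
move/(canRL (divgK _)) => ->.
elim: s sS => [_|x s IH sS].
  by rewrite mulr0 big_nil mul1g; exact: joined_within_refl.
rewrite big_cons /= -addn1 natrD mulrDr mulr1 -mulgA.
have [v vx] := sS x (mem_head _ _).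
apply: joined_within_trans (star_joined _ vx).
by apply: IH => y ys; apply: sS; rewrite inE ys orbT.
Qed.

Lemma realization_near (p : realization E) :
  exists g, joined_within (N%:R + 1) p (orbit g).
Proof.
have [|a pa] := point_near_vertex edge_ge0 p.
  by move=> a b l /edge_length/andP[].
have [g ga] := orbit_near a; exists g; rewrite addrC.
exact: joined_within_trans pa (joined_within_sym ga).
Qed.

Lemma realization_joined (p q : realization E) :
  exists M : R, joined_within M p q.
Proof.
have [g pg] := realization_near p; have [h qh] := realization_near q.
eexists; apply: joined_within_trans pg _.
apply: joined_within_trans (joined_within_sym qh).
exact: orbit_joined.
Qed.

Lemma star_graph_triangle (p q s : realization E) :
  path_metric p s <= path_metric p q + path_metric q s.
Proof.
by apply: (path_metric_triangle edge_ge0); exact: realization_joined.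
Qed.

(** The lower bound on the path metric applies the Lipschitz estimate to the star
    distance from [r (F h)]. *)
Lemma star_dist_quasi_isometric :
  quasi_isometric (@star_dist G R) (@path_metric R V E).
Proof.
(* The factor 2 comes from the edges having length at least 1/2. *)
exists (fun g => orbit g), (2 * N%:R + 1), (N%:R + 1).
have N0 : 0 <= N%:R :> R by [].
have K0 : 0 < 2 * N%:R + 1 :> R by lra.
split; [lra | lra | | ]; last first.
  move=> p; have [g pg] := realization_near p.
  by exists g; exact: path_metric_joined pg.
move=> g h; apply/andP; split; last first.
  rewrite path_metric_sym.
  apply: le_trans (path_metric_joined _ (orbit_joined g h)) _ => //.
  rewrite /star_dist; set d : R := (star_length _)%:R.
  have Nd0 : 0 <= N%:R * d by exact: mulr_ge0.
  have d0 : 0 <= d by [].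
  by lra.
apply: (path_metric_ge realization_joined) => L ghL.
pose phi a : R := (star_length (r a / r (F h))%g)%:R.
have phi_edge a b l : E a b l -> `|phi a - phi b| <= (2 * N%:R + 1) * l.
  move=> ab; have /andP[l2 _] := edge_length ab.
  apply: (@le_trans _ _ N%:R); last first.
    apply: (@le_trans _ _ ((2 * N%:R + 1) * 2^-1)); first by lra.
    by rewrite ler_pM2l.
  have := edge_star ab; have := star_length_triangle (r b) (r a) (r (F h)).
  have := star_length_triangle (r a) (r b) (r (F h)).
  rewrite (star_length_div (r b) (r a)) -!(ler_nat R) !natrD -!/(phi _).
  by rewrite ler_norml => *; apply/andP; split; lra.
have := vertex_lipschitz phi_edge ghL; rewrite {2}/phi mulgV star_length1 subr0.
rewrite ger0_norm // /phi => rL.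
rewrite lerBlDr ler_pdivrMl // /star_dist.
have := star_length_triangle (r (F g)) g h.
have := star_length_triangle (r (F h)) (r (F g)) h.
have := orbit_star g; have := orbit_star h.
rewrite (star_length_div h) -!(ler_nat R) !natrD => *.
have : (2 * N%:R + 1) * N%:R >= 0 :> R by rewrite mulr_ge0 // ltW.
by lra.
Qed.

End StarMetricGraph.

(** * The extension graph and the electrification *)

Section ExtensionGraph.
Local Open Scope ring_scope.
Variables (R : realType) (G : sgraph).
Implicit Types (v w : G) (x g : raag G).

Definition ext_conj v g : ext_vertex G :=
  exist _ (raag_gen v ^ g)%g (ex_intro _ v (ex_intro _ g erefl)).

Local Notation ext_point v g := (vertex_point (@ext_edge R G) (ext_conj v g)).

Lemma ext_edge_length (a b : ext_vertex G) (l : R) :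
  ext_edge a b l -> 2^-1 <= l <= 1.
Proof. by case=> _ ->; apply/andP; split; lra. Qed.

Lemma ext_joined_path v (p : seq G) g : path (@adj G) v p ->
  joined_within (size p)%:R (ext_point v g) (ext_point (last v p) g).
Proof.
elim: p v => [|w p IH] v /=; first by move=> _; exact: joined_within_refl.
case/andP=> vw /IH; rewrite -add1n natrD; apply: joined_within_trans.
exists 1 => //; apply: pl_path_edge; split=> //; split.
  by case=> /conjg_inj/gen_inj vw_eq; rewrite vw_eq adj_irr in vw.
exact/commute_conj/gen_commute.
Qed.

Hypothesis G_connected : connected_graph G.

Lemma ext_joined v w g :
  joined_within #|G|%:R (ext_point v g) (ext_point w g).
Proof.
have /connectP[p vp ->] := G_connected.2 v w.
case/shortenP: vp => p' vp' uniq_p' _.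
apply: joined_within_le (ext_joined_path g vp').
rewrite ler_nat; apply: ltnW.
by have := max_card (mem (v :: p')); rewrite (card_uniqP uniq_p').
Qed.

(** The element [x] commutes with [w], so the vertices [w ^ g] and [w ^ (x g)]
    coincide and one can pass through them. *)
Lemma ext_star_joined v w x g : star_subgroup w x ->
  joined_within (#|G|%:R + #|G|%:R) (ext_point v g) (ext_point v (x * g)%g).
Proof.
move=> /star_subgroup_centralizes wx.
apply: joined_within_trans (ext_joined v w g) _.
suff -> : ext_conj w g = ext_conj w (x * g)%g by exact: ext_joined.
by apply: eq_exist; rewrite conjgM [(_ ^ x)%g]conjgE wx mulKg.
Qed.

(** The map back to the group sends a vertex to any [g] exhibiting it as some
    [v ^ g]; two choices, like the two ends of an edge, give commuting conjugates. *)
Lemma star_dist_ext :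
  quasi_isometric (@star_dist G R) (@ext_dist R G) /\
  forall p q s : ext_graph R G, ext_dist p s <= ext_dist p q + ext_dist q s.
Proof.
have [[v0] _] := G_connected.
have /choice[r rE] : forall a : ext_vertex G, exists (g : raag G) v,
    sval a = (raag_gen v ^ g)%g by case=> a [v [g aE]]; exists g, v.
pose N := (2 * #|G| + 2)%N.
have edge_star (a b : ext_vertex G) (l : R) :
    ext_edge a b l -> (star_length (r a / r b)%g <= N)%N.
  case=> -[_ ab] _; have [v aE] := rE a; have [w bE] := rE b.
  rewrite aE bE in ab; apply: leq_trans (star_length_commute ab) _.
  by rewrite leq_addl.
have orbit_star (g : raag G) : (star_length (g / r (ext_conj v0 g))%g <= N)%N.
  have [v vE] := rE (ext_conj v0 g).
  have /star_length_commute/leq_trans : commute (raag_gen v0 ^ g)%g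
    (raag_gen v ^ r (ext_conj v0 g))%g by rewrite -vE; exact: commute_refl.
  by apply; rewrite leq_addl.
have star_joined v x g : star_subgroup v x ->
    joined_within N%:R (ext_point v0 g) (ext_point v0 (x * g)%g).
  move/(ext_star_joined v0 g); apply: joined_within_le.
  by rewrite -natrD ler_nat addnn -mul2n leq_addr.
have orbit_near (a : ext_vertex G) : exists g : raag G,
    joined_within N%:R (ext_point v0 g) (vertex_point (@ext_edge R G) a).
  case: a => a [v [g aE]]; exists g.
  have -> : exist _ a (ex_intro _ v (ex_intro _ g aE)) = ext_conj v g.
    exact: eq_exist.
  apply: joined_within_le (ext_joined v0 v g).
  by rewrite ler_nat /N; lia.
split; first exact: star_dist_quasi_isometric ext_edge_length edge_star
  orbit_star star_joined orbit_near.
exact: star_graph_triangle ext_edge_length star_joined orbit_near.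
Qed.

End ExtensionGraph.

Section Electrification.
Local Open Scope ring_scope.
Variables (R : realType) (G : sgraph).
Implicit Types (v w : G) (x g : raag G).

Local Notation elec_point a := (vertex_point (@elec_edge R G) a).

Definition elec_base (a : elec_vertex G) : raag G :=
  match a with
  | inl g => g
  | inr (existT v C) => xget 1%g (sval C)
  end.

Lemma star_coset_div v g (C : star_coset v) :
  sval C g -> star_subgroup v (g / xget 1 (sval C))%g.
Proof.
move=> Cg; have := xgetI 1%g Cg.
case: (svalP C) => k CE; move: Cg; rewrite {1 2}CE.
move=> [x vx <-] [y vy yE]; rewrite -yE invgM mulgA mulgK.
by apply: star_subgroupM => //; exact: star_subgroupV.
Qed.

Lemma elec_cone_joined v g (C : star_coset v) : sval C g ->
  joined_within 2^-1 (elec_point (inl g)) (elec_point (inr (existT _ v C))).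
Proof.
by move=> Cg; exists 2^-1 => //; apply: pl_path_edge; exact: Elec_cone.
Qed.

Lemma elec_edge_length (a b : elec_vertex G) (l : R) :
  elec_edge a b l -> 2^-1 <= l <= 1.
Proof. by case=> *; apply/andP; split; lra. Qed.

Lemma star_dist_elec :
  quasi_isometric (@star_dist G R) (@elec_dist R G) /\
  forall p q s : elec_graph R G, elec_dist p s <= elec_dist p q + elec_dist q s.
Proof.
have edge_star (a b : elec_vertex G) (l : R) :
    elec_edge a b l -> (star_length (elec_base a / elec_base b)%g <= 1)%N.
  case=> {a b l} [g s [v vs]|g v C Cg] /=; last first.
    exact: star_length_star (star_coset_div Cg).
  rewrite invgM mulgA mulgV mul1g star_lengthV; apply: (@star_length_star _ v).
  have sv : star_subgroup v (raag_gen v) by apply: star_subgroup_gen; left.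
  by case: vs => -> //; exact: star_subgroupV.
have orbit_star (g : raag G) : (star_length (g / elec_base (inl g))%g <= 1)%N.
  by rewrite mulgV star_length1.
have star_joined v x g : star_subgroup v x ->
    joined_within 1 (elec_point (inl g)) (elec_point (inl (x * g)%g)).
  move=> vx; have [C CE] : exists C : star_coset v,
      sval C = right_coset (star_subgroup v) g.
    pose Cg := right_coset (star_subgroup v) g.
    by exists (exist _ Cg (ex_intro _ g erefl)).
  have -> : 1 = 2^-1 + 2^-1 :> R by lra.
  apply: (@joined_within_trans _ _ _ _ _ (elec_point (inr (existT _ v C)))).
    apply: elec_cone_joined; rewrite CE; exists 1%g; last by rewrite mul1g.
    exact: star_subgroup1.
  by apply/joined_within_sym/elec_cone_joined; rewrite CE; exists x.
have orbit_near (a : elec_vertex G) :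
    exists g, joined_within 1 (elec_point (inl g)) (elec_point a).
  case: a => [g|[v C]]; first by exists g; exact: joined_within_refl.
  have [g CE] := svalP C.
  have Cg : sval C g.
    by rewrite CE; exists 1%g; [exact: star_subgroup1 | rewrite mul1g].
  by exists g; apply: joined_within_le (elec_cone_joined Cg); lra.
split; first exact: (star_dist_quasi_isometric (N := 1) elec_edge_length
  edge_star orbit_star star_joined orbit_near).
exact: (star_graph_triangle (N := 1) elec_edge_length star_joined orbit_near).
Qed.

End Electrification.

Theorem theorem15 (R : realType) (G : sgraph) (hG : connected_graph G) :
  [/\ quasi_isometric (@star_dist G R) (@ext_dist R G),
      quasi_isometric (@star_dist G R) (@elec_dist R G)
    & quasi_isometric (@ext_dist R G) (@elec_dist R G)].
Proof.
have [ext_qi ext_triangle] := star_dist_ext R hG.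
have [elec_qi elec_triangle] := star_dist_elec R G.
split=> //; apply: quasi_isometric_span ext_qi elec_qi => //.
exact: path_metric_sym.
Qed.
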